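(* Consider the family of Sugeno-Weber t-norms $(T^{\mathbf{SW}}_{\lambda})_{\lambda\in[0,\infty]}$. Then, for all $\lambda,\mu\in[0,\infty]$, $T^{\mathbf{SW}}_{\lambda}$ dominates $T^{\mathbf{SW}}_{\mu}$ (i.e. $T^{\mathbf{SW}}_{\lambda}\gg T^{\mathbf{SW}}_{\mu}$) if and only if at least one of the following conditions holds: (i) $\lambda=0$; (ii) $\mu=\infty$; (iii) $\lambda=\mu$; (iv) $0<\lambda<\mu\leq 17+12\sqrt2$; (v) $17+12\sqrt2<\mu<\infty$ and $0<\lambda\leq\Bigl(\frac{1-3\sqrt{\mu}}{3-\sqrt{\mu}}\Bigr)^2$.
   Context: A t-norm is a binary operation $T\colon[0,1]^2\to[0,1]$ that is commutative, associative, increasing (non-decreasing in each argument) and has neutral element $1$. Dominance: for t-norms $T_1,T_2$, $T_1$ dominates $T_2$, written $T_1\gg T_2$, if for all $x,y,u,v\in[0,1]$, $$T_1(T_2(x,y),T_2(u,v))\geq T_2(T_1(x,u),T_1(y,v)).$$ The Sugeno-Weber t-norms $(T^{\mathbf{SW}}_{\lambda})_{\lambda\in[0,\infty]}$ are given, for $u,v\in[0,1]$, by $T^{\mathbf{SW}}_{0}(u,v)=uv$ (the product); $T^{\mathbf{SW}}_{\infty}(u,v)=\min(u,v)$ if $\max(u,v)=1$ and $T^{\mathbf{SW}}_{\infty}(u,v)=0$ otherwise (the drastic product); and $T^{\mathbf{SW}}_{\lambda}(u,v)=\max\bigl(0,(1-\lambda)uv+\lambda(u+v-1)\bigr)$ for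 $\lambda\in\,]0,\infty[$. *)

(* Defs.v *)
From mathcomp Require Import all_boot all_order all_algebra.
From mathcomp Require Import ring lra.
From mathcomp Require Import reals constructive_ereal.

Set Implicit Arguments.
Unset Strict Implicit.
Unset Printing Implicit Defensive.

Import Order.TTheory GRing.Theory Num.Theory.

Local Open Scope ring_scope.

(* A binary operation on [0, 1] is represented by a function on R of which only
   the values on [0, 1]^2 matter. *)
Record tnorm (R : realType) := Tnorm {
  tnorm_fun :> R -> R -> R;
  tnorm_itv : {in `[0, 1] &, forall x y, tnorm_fun x y \in `[0, 1]};
  tnormC : {in `[0, 1] &, commutative tnorm_fun};
  tnormA : {in `[0, 1] & &, associative tnorm_fun};
  tnorm_ler : {in `[0, 1] & &, forall z x y,
    x <= y -> tnorm_fun z x <= tnorm_fun z y};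
  tnorm_lel : {in `[0, 1] & &, forall z x y,
    x <= y -> tnorm_fun x z <= tnorm_fun y z};
  tnormx1 : {in `[0, 1], right_id 1 tnorm_fun};
  tnorm1x : {in `[0, 1], left_id 1 tnorm_fun} }.

Definition dominates (R : realType) (T1 T2 : tnorm R) : Prop :=
  forall x y u v : R,
    x \in `[0, 1] -> y \in `[0, 1] -> u \in `[0, 1] -> v \in `[0, 1] ->
    T2 (T1 x u) (T1 y v) <= T1 (T2 x y) (T2 u v).

(* The value at -oo is irrelevant: the parameter ranges over [0, +oo]. *)
Definition SW_fun (R : realType) (lambda : \bar R) (u v : R) : R :=
  match lambda with
  | EFin l => if l == 0 then u * v
              else Num.max 0 ((1 - l) * u * v + l * (u + v - 1))
  | +oo%E => if Num.max u v == 1 then Num.min u v else 0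
  | -oo%E => 0
  end.

Section SugenoWeber.
Variable R : realType.

Let F (l u v : R) := (1 - l) * u * v + l * (u + v - 1).

Let SWE l u v : 0 <= l -> u \in `[0, 1] -> v \in `[0, 1] ->
  SW_fun l%:E u v = Num.max 0 (F l u v).
Proof.
rewrite /SW_fun /F !in_itv /= => _ /andP[u0 _] /andP[v0 _].
case: eqP => // ->; rewrite subr0 mul1r mul0r addr0.
by rewrite max_r // mulr_ge0.
Qed.

Let F_le l x y z : 0 <= l -> z \in `[0, 1] -> x <= y -> F l x z <= F l y z.
Proof.
rewrite /F in_itv /= => l0 /andP[z0 z1] xy; rewrite -subr_ge0.
have : 0 <= (y - x) * (z + l * (1 - z)).
  by apply: mulr_ge0; rewrite ?subr_ge0 // addr_ge0 // mulr_ge0 // subr_ge0.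
by congr (_ <= _); ring.
Qed.

Let FC l x y : F l x y = F l y x. Proof. by rewrite /F; ring. Qed.

Let FA l x y z : F l x (F l y z) = F l (F l x y) z.
Proof. by rewrite /F; ring. Qed.

Let F_le1 l x y : 0 <= l -> x \in `[0, 1] -> y \in `[0, 1] -> F l x y <= 1.
Proof.
rewrite /F !in_itv /= => l0 /andP[x0 x1] /andP[y0 y1].
have : 0 <= l * ((1 - x) * (1 - y)) by rewrite !mulr_ge0 // subr_ge0.
have : x * y <= 1 by rewrite mulr_ile1.
lra.
Qed.

Let max_F l x y z : 0 <= l -> z \in `[0, 1] ->
  Num.max 0 (F l (Num.max 0 (F l x y)) z) = Num.max 0 (F l (F l x y) z).
Proof.
move=> l0 z01; case: (leP 0 (F l x y)) => // /ltW Flt.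
have F0 : F l 0 z <= 0.
  by move: z01; rewrite /F in_itv /= => /andP[z0 z1]; nra.
by rewrite !max_l // (le_trans (F_le l0 z01 Flt)).
Qed.

Let maxF_itv l x y : 0 <= l -> x \in `[0, 1] -> y \in `[0, 1] ->
  Num.max 0 (F l x y) \in `[0, 1].
Proof.
move=> l0 x01 y01.
by rewrite in_itv /= le_max lexx /= ge_max ler01 F_le1.
Qed.

Let drastic_le (x y z : R) : z \in `[0, 1] -> x \in `[0, 1] -> y \in `[0, 1] ->
  x <= y -> SW_fun +oo%E x z <= SW_fun +oo%E y z.
Proof.
rewrite /SW_fun !in_itv /= => /andP[z0 z1] /andP[x0 x1] /andP[y0 y1] xy.
by case: eqP; case: eqP; case: (leP x z); case: (leP y z); lra.
Qed.

Lemma SW_itv (lambda : \bar R) : (0 <= lambda)%E ->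
  {in `[0, 1] &, forall x y, SW_fun lambda x y \in `[0, 1]}.
Proof.
case: lambda => [l| |] // l0 x y x01 y01.
  by rewrite SWE // maxF_itv.
move: x01 y01; rewrite /SW_fun !in_itv /= => /andP[x0 x1] /andP[y0 y1].
by case: eqP; case: (leP x y); lra.
Qed.

Lemma SWC (lambda : \bar R) : (0 <= lambda)%E ->
  {in `[0, 1] &, commutative (SW_fun lambda)}.
Proof.
case: lambda => [l| |] // l0 x y x01 y01.
  by rewrite !SWE // FC.
by rewrite /SW_fun maxC minC.
Qed.

Lemma SWA (lambda : \bar R) : (0 <= lambda)%E ->
  {in `[0, 1] & &, associative (SW_fun lambda)}.
Proof.
case: lambda => [l| |] // l0 x y z x01 y01 z01.
  rewrite (SWE l0 y01 z01) (SWE l0 x01 y01) !SWE ?maxF_itv //.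
  by rewrite max_F // (FC l x) max_F // (FC l (F l y z)) FA.
move: x01 y01 z01; rewrite /SW_fun !in_itv /=.
move=> /andP[x0 x1] /andP[y0 y1] /andP[z0 z1].
have D1 (a : R) : 0 <= a -> a <= 1 ->
    (if Num.max a 1 == 1 then Num.min a 1 else 0) = a.
  by move=> a0 a1; rewrite max_r // eqxx min_l.
have D0 (a : R) : 0 <= a -> a <= 1 ->
    (if Num.max a 0 == 1 then Num.min a 0 else 0) = 0.
  by move=> a0 a1; rewrite max_l // min_r // if_same.
have Dn (a b : R) : a != 1 -> b != 1 ->
    (if Num.max a b == 1 then Num.min a b else 0) = 0.
  by move=> a1 b1; case: (leP a b) => _; rewrite ?(negPf a1) ?(negPf b1).
have DC (a b : R) : (if Num.max a b == 1 then Num.min a b else 0) =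
    (if Num.max b a == 1 then Num.min b a else 0) by rewrite maxC minC.
have [->|nx] := eqVneq x 1.
  by rewrite (DC 1 y) D1 // DC D1 //; case: ifP => // _; case: (leP y z).
have [->|ny] := eqVneq y 1.
  by rewrite (DC 1 z) D1 // D1.
have [->|nz] := eqVneq z 1.
  by rewrite D1 // D1 // Dn.
by rewrite (Dn y z) // (Dn x y) // D0 // DC D0.
Qed.

Lemma SW_lel (lambda : \bar R) : (0 <= lambda)%E ->
  {in `[0, 1] & &, forall z x y, x <= y -> SW_fun lambda x z <= SW_fun lambda y z}.
Proof.
case: lambda => [l| |] // l0 z x y z01 x01 y01 xy; last exact: drastic_le.
by rewrite !SWE // ge_max !le_max lexx /= F_le // orbT.
Qed.

Lemma SW_ler (lambda : \bar R) : (0 <= lambda)%E ->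
  {in `[0, 1] & &, forall z x y, x <= y -> SW_fun lambda z x <= SW_fun lambda z y}.
Proof.
move=> l0 z x y z01 x01 y01 xy.
by rewrite (SWC l0 z01 x01) (SWC l0 z01 y01) SW_lel.
Qed.

Lemma SWx1 (lambda : \bar R) : (0 <= lambda)%E ->
  {in `[0, 1], right_id 1 (SW_fun lambda)}.
Proof.
case: lambda => [l| |] // l0 x x01.
  rewrite SWE // ?in_itv /= ?ler01 ?lexx //.
  have -> : F l x 1 = x by rewrite /F; ring.
  by move: x01; rewrite in_itv /= => /andP[x0 _]; rewrite max_r.
move: x01; rewrite in_itv /SW_fun /= => /andP[x0 x1].
by rewrite max_r // eqxx min_l.
Qed.

Lemma SW1x (lambda : \bar R) : (0 <= lambda)%E ->
  {in `[0, 1], left_id 1 (SW_fun lambda)}.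
Proof.
move=> l0 x x01; rewrite (SWC l0) ?SWx1 //.
by rewrite in_itv /= ler01 lexx.
Qed.

End SugenoWeber.

Definition SW (R : realType) (lambda : \bar R) (lambda_ge0 : (0 <= lambda)%E) :
    tnorm R :=
  Tnorm (SW_itv lambda_ge0) (SWC lambda_ge0) (SWA lambda_ge0)
        (SW_ler lambda_ge0) (SW_lel lambda_ge0)
        (SWx1 lambda_ge0) (SW1x lambda_ge0).

(* Main.v *)
(** Write [p = lambda - 1], [q = mu - 1] and [A_k a b = a + b + k a b], so that
    in the complements of its arguments [SW lambda] is [max 0 (1 - A_p a b)].
    Everything rests on the identity
      [A_q (A_p x u) (A_p y v) - A_p (A_q x y) (A_q u v)
         = (q - p) (x v + u y - p q x y u v)]:
    for [p < q], dominance means that [p q x y u v <= x v + u y] as soon as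
    [A_q (A_p x u) (A_p y v) < 1].  By the AM-GM inequality the worst case is
    [x = y = u = v = a], where the condition is violated iff some [a] satisfies
    both [2 < p q a ^ 2] and [2 q a + p q a ^ 2 < sqrt mu - 1], that is, iff
    [3 < sqrt mu] and [8 q < p (sqrt mu - 3) ^ 2]. *)
Require Import Defs.
From mathcomp Require Import all_boot all_order all_algebra.
From mathcomp Require Import ring lra.
From mathcomp Require Import reals constructive_ereal.
Import Order.TTheory GRing.Theory Num.Theory.
Local Open Scope ring_scope.

(** * Complement sums: monotonicity and mean inequalities *)

Definition csum {R : pzRingType} (k a b : R) : R := a + b + k * a * b.

Section Csum.
Context {R : rcfType}.
Implicit Types k p q a b c x y u v : R.

Lemma csumC k a b : csum k a b = csum k b a.
Proof. by rewrite /csum; ring. Qed.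

Lemma csum_le k a b c : -1 <= k -> 0 <= c <= 1 -> a <= b ->
  csum k a c <= csum k b c.
Proof.
rewrite /csum => k1 /andP[c0 c1] ab; rewrite -subr_ge0.
(* The slope [1 + k * c] in the first argument is written as a sum of two nonnegative terms. *)
have : 0 <= (b - a) * ((1 - c) + (k + 1) * c).
  apply: mulr_ge0; first by rewrite subr_ge0.
  by apply: addr_ge0; [|apply: mulr_ge0]; lra.
by congr (_ <= _); ring.
Qed.

Lemma le_csum k a b : -1 <= k -> 0 <= a -> 0 <= b <= 1 -> a <= 1 ->
  a <= csum k a b.
Proof.
move=> k1 a0 b01 a1; rewrite csumC.
have := csum_le k 0 b a k1; rewrite a0 a1 => /(_ isT).
by case/andP: b01 => b0 _ /(_ b0); rewrite /csum; lra.
Qed.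

Lemma csum_swap p q x y u v :
  csum q (csum p x u) (csum p y v) - csum p (csum q x y) (csum q u v) =
  (q - p) * (x * v + u * y - p * q * (x * y * u * v)).
Proof. by rewrite /csum; ring. Qed.

Lemma csum_AGM k a b t : 0 <= k -> 0 <= a -> 0 <= b -> 0 <= t ->
  t ^+ 2 <= a * b -> csum k t t <= csum k a b.
Proof.
move=> k0 a0 b0 t0 tab; rewrite /csum -!mulrA.
have t2 : t + t <= a + b.
  rewrite -(@ler_pXn2r _ 2) ?nnegrE ?addr_ge0 //.
  by have := sqr_ge0 (a - b); nra.
by rewrite lerD // ler_wpM2l // -expr2.
Qed.

(** The diagonal [2 a + p a ^ 2] is geometrically convex: once [a * b] is fixed, the product of its
    two values depends only on [a + b], which AM-GM bounds below by [2 t]. *)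
Lemma csum_diag_AGM p a b t : 0 <= p -> 0 <= a -> 0 <= b -> 0 <= t ->
  t ^+ 2 = a * b -> csum p t t ^+ 2 <= csum p a a * csum p b b.
Proof.
move=> p0 a0 b0 t0 tab.
have t2 : t + t <= a + b.
  rewrite -(@ler_pXn2r _ 2) ?nnegrE ?addr_ge0 //.
  by have := sqr_ge0 (a - b); nra.
have -> : csum p t t ^+ 2 =
    t ^+ 2 * (4 + 2 * p * (t + t) + p ^+ 2 * t ^+ 2) by rewrite /csum; ring.
have -> : csum p a a * csum p b b =
    a * b * (4 + 2 * p * (a + b) + p ^+ 2 * (a * b)) by rewrite /csum; ring.
by rewrite tab ler_wpM2l ?mulr_ge0 // lerD // lerD // ler_wpM2l // mulr_ge0.
Qed.

(** Geometric means are taken twice, first within the pairs [(x, u)] and [(y, v)], then between the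
    two results; [a] is thus the fourth root of [x u y v]. *)
Lemma csum_worst p q x y u v a : 0 <= p -> 0 <= q ->
    0 <= x -> 0 <= y -> 0 <= u -> 0 <= v ->
  a = Num.sqrt (Num.sqrt (x * u) * Num.sqrt (y * v)) ->
  csum q (csum p a a) (csum p a a) <= csum q (csum p x u) (csum p y v).
Proof.
move=> p0 q0 x0 y0 u0 v0 aE.
have A0 b c : 0 <= b -> 0 <= c -> 0 <= csum p b c.
  by move=> b0 c0; rewrite /csum !addr_ge0 // !mulr_ge0.
have xu0 : 0 <= Num.sqrt (x * u) by rewrite sqrtr_ge0.
have yv0 : 0 <= Num.sqrt (y * v) by rewrite sqrtr_ge0.
have a0 : 0 <= a by rewrite aE sqrtr_ge0.
apply: csum_AGM; rewrite ?A0 //.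
apply: (@le_trans _ _ (csum p (Num.sqrt (x * u)) (Num.sqrt (x * u)) *
  csum p (Num.sqrt (y * v)) (Num.sqrt (y * v)))).
  by apply: csum_diag_AGM; rewrite // aE sqr_sqrtr ?mulr_ge0.
by apply: ler_pM; rewrite ?A0 // csum_AGM // sqr_sqrtr // mulr_ge0.
Qed.

(** * The inequality for complement sums and its failure on the diagonal *)

Lemma csum_diag_lt1 q s m : 0 < q -> q = s ^+ 2 - 1 -> 0 <= s -> 0 <= m ->
  (csum q m m < 1) = (q * m < s - 1).
Proof.
move=> q0 qs s0 m0.
(* Completing the square: [1 + q * csum q m m = (1 + q * m) ^ 2], while [1 + q = s ^ 2]. *)
have -> : (q * m < s - 1) = ((1 + q * m) ^+ 2 < s ^+ 2).
  rewrite ltr_pXn2r ?nnegrE //; first by rewrite ltrBrDl.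
  by rewrite addr_ge0 // mulr_ge0 // ltW.
have -> : s ^+ 2 = q * 1 + 1 by rewrite qs; ring.
have -> : (1 + q * m) ^+ 2 = q * csum q m m + 1 by rewrite /csum; ring.
by rewrite ltrD2r ltr_pM2l.
Qed.

Lemma csum_dominance p q s x y u v : -1 <= p -> -1 <= q ->
    q = s ^+ 2 - 1 -> 0 <= s -> (3 < s -> p * (s - 3) ^+ 2 <= 8 * q) ->
    0 <= x <= 1 -> 0 <= y <= 1 -> 0 <= u <= 1 -> 0 <= v <= 1 ->
    p < q -> csum q (csum p x u) (csum p y v) < 1 ->
  p * q * (x * y * u * v) <= x * v + u * y.
Proof.
move=> p1 q1 qs s0 psq /andP[x0 x1] /andP[y0 y1] /andP[u0 u1] /andP[v0 v1] pq.
have xv0 : 0 <= x * v by rewrite mulr_ge0.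
have uy0 : 0 <= u * y by rewrite mulr_ge0.
have xv1 : x * v <= 1 by rewrite mulr_ile1.
have Exyuv : x * y * u * v = (x * v) * (u * y) by ring.
have W0 : 0 <= x * y * u * v by rewrite Exyuv mulr_ge0.
have Wuy : x * y * u * v <= u * y by rewrite Exyuv ler_piMl.
have [pq1 _|pq1] := leP (p * q) 1.
  by apply: (@le_trans _ _ (1 * (x * y * u * v))); rewrite ?ler_wpM2r //; lra.
(* If [p <= 0], then [1 < p * q] would force [q < 0], but two numbers in [[-1, 0]] have product at
   most 1. *)
have p0 : 0 < p by rewrite ltNge; apply/negP => p0; nra.
have q0 : 0 < q by lra.
move=> Rlt1; rewrite leNgt; apply/negP => Hlt.
pose a := Num.sqrt (Num.sqrt (x * u) * Num.sqrt (y * v)).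
have Wa := csum_worst p q x y u v a (ltW p0) (ltW q0) x0 y0 u0 v0 erefl.
have := le_lt_trans Wa Rlt1.
have a0 : 0 <= a by rewrite sqrtr_ge0.
have a2E : a ^+ 2 ^+ 2 = x * v * (u * y).
  rewrite sqr_sqrtr ?mulr_ge0 ?sqrtr_ge0 // exprMn !sqr_sqrtr ?mulr_ge0 //.
  by ring.
(* AM-GM and the assumed violation give [2 a ^ 2 <= x v + u y < p q a ^ 4]; then [a ^ 2] is
   cancelled. *)
have a2 : 2 < p * q * a ^+ 2.
  have a2sum : 2 * a ^+ 2 <= x * v + u * y.
    rewrite -(@ler_pXn2r _ 2) ?nnegrE ?addr_ge0 ?mulr_ge0 ?sqr_ge0 //.
    by rewrite exprMn a2E; have := sqr_ge0 (x * v - u * y); nra.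
  have : 2 * a ^+ 2 < p * q * a ^+ 2 * a ^+ 2.
    by rewrite -mulrA -expr2 a2E -Exyuv (le_lt_trans a2sum).
  rewrite ltr_pM2r // lt_neqAle sqr_ge0 andbT eq_sym; apply/eqP => a20.
  by move: a2E Hlt; rewrite a20 expr0n /= -Exyuv => <-; lra.
rewrite (@csum_diag_lt1 q s) //; last first.
  by rewrite /csum !addr_ge0 // !mulr_ge0 // ltW.
have -> : q * csum p a a = 2 * q * a + p * q * a ^+ 2 by rewrite /csum; ring.
move=> lts.
(* Removing [p q a ^ 2], which exceeds 2, and squaring gives [8 q < 4 q (p q a ^ 2) = p (2 q a) ^ 2
   < p (s - 3) ^ 2], against the hypothesis. *)
have qa : 2 * q * a < s - 3 by lra.
have qa0 : 0 <= 2 * q * a by rewrite !mulr_ge0 // ltW.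
have s3 : 3 < s by lra.
have qa2 : (2 * q * a) ^+ 2 < (s - 3) ^+ 2.
  by rewrite ltr_pXn2r ?nnegrE //; lra.
have : p * (2 * q * a) ^+ 2 < p * (s - 3) ^+ 2 by rewrite ltr_pM2l.
have -> : p * (2 * q * a) ^+ 2 = 4 * q * (p * q * a ^+ 2) by ring.
have : 4 * q * 2 < 4 * q * (p * q * a ^+ 2) by rewrite ltr_pM2l // mulr_gt0.
by have := psq s3; lra.
Qed.

Lemma csum_diag_violation p q s : 0 < q -> q = s ^+ 2 - 1 -> 3 < s ->
    8 * q < p * (s - 3) ^+ 2 ->
  exists2 a, 0 < a < 1 &
    csum q (csum p a a) (csum p a a) < 1 /\ 2 < p * q * a ^+ 2.
Proof.
move=> q0 qs s3 psq.
have p0 : 0 < p.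
  by rewrite ltNge; apply/negP => p0; have := sqr_ge0 (s - 3); nra.
(* At [a = c] the second inequality becomes an equality while the first one
   holds strictly; [a] is a slightly larger value. *)
pose c := Num.sqrt (2 / (p * q)).
have c0 : 0 < c by rewrite sqrtr_gt0 divr_gt0 ?mulr_gt0.
have c2 : p * q * c ^+ 2 = 2.
  rewrite sqr_sqrtr ?divr_ge0 ?mulr_ge0 1?ltW //; field.
  by rewrite !gt_eqF.
have cs : 2 * q * c < s - 3.
  rewrite -(@ltr_pXn2r _ 2) ?nnegrE ?mulr_ge0 1?ltW //; last by lra.
  rewrite -(ltr_pM2l p0).
  suff -> : p * (2 * q * c) ^+ 2 = 8 * q by [].
  have -> : 8 * q = 4 * q * (p * q * c ^+ 2) by rewrite c2; ring.
  by ring.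
pose d := s - 3 - 2 * q * c.
have d0 : 0 < d by rewrite /d; lra.
(* The slack at [c] is [d], and moving to [c + e] with [0 < e < 1] raises [2 q a + p q a ^ 2] by at
   most [K * e]; the choice [e = d / (K + d)] ensures [e < 1] and [K * e < d]. *)
pose K := 2 * q + 2 * (p * q * c) + p * q.
have pq0 : 0 < p * q by rewrite mulr_gt0.
have pqc0 : 0 < p * q * c by rewrite mulr_gt0.
have K0 : 0 < K by rewrite /K; lra.
pose e := d / (K + d).
have Kd0 : 0 < K + d by lra.
have e0 : 0 < e by rewrite divr_gt0.
have e1 : e < 1 by rewrite ltr_pdivrMr //; lra.
have eK : K * e < d.
  have : e * (K + d) = d by rewrite divfK // gt_eqF.
  by have : 0 < e * d by [rewrite mulr_gt0]; lra.
have e2 : p * q * e ^+ 2 <= p * q * e.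
  by rewrite ler_pM2l // expr2 ler_piMl // ltW.
have a2 : p * q * (c + e) ^+ 2 = 2 + 2 * (p * q * c) * e + p * q * e ^+ 2.
  by rewrite -[X in _ = X + _ + _]c2; ring.
have pqce0 : 0 < p * q * c * e by rewrite mulr_gt0.
have pqee0 : 0 < p * q * e ^+ 2 by rewrite mulr_gt0 // exprn_gt0.
have small : 2 * q * (c + e) + p * q * (c + e) ^+ 2 < s - 1.
  by rewrite a2; move: eK; rewrite /K /d; lra.
have a0 : 0 < c + e by rewrite addr_gt0.
have m0 : 0 <= csum p (c + e) (c + e).
  by rewrite /csum -mulrA -expr2 ltW // !addr_gt0 // mulr_gt0 // exprn_gt0.
exists (c + e).
  rewrite a0 /=.
  have : 2 * q * (c + e) < s - 1 by move: small; rewrite a2; lra.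
  by rewrite qs; nra.
split; last by rewrite a2; lra.
rewrite (@csum_diag_lt1 q s) //; last by lra.
by move: small; congr (_ < _); rewrite /csum; ring.
Qed.

End Csum.

(** * Dominance between arbitrary t-norms *)

Section Dominance.
Context {R : realType}.
Implicit Types (T : tnorm R) (x y u v a b l m s : R).

Lemma tnorm_le T x y : x \in `[0, 1] -> y \in `[0, 1] ->
  T x y <= x /\ T x y <= y.
Proof.
have I1 : (1 : R) \in `[0, 1] by rewrite in_itv /= ler01 lexx.
move=> x01 y01.
have := tnorm_ler T x01 y01 I1; rewrite tnormx1 //.
have := tnorm_lel T y01 x01 I1; rewrite tnorm1x //.
by move: x01 y01; rewrite !in_itv /= => /andP[_ x1] /andP[_ y1]; auto.
Qed.

(** Two inner arguments equal to the neutral element collapse the dominance inequality to a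
    pointwise comparison. *)
Lemma dominates_le T1 T2 x v : dominates T1 T2 ->
  x \in `[0, 1] -> v \in `[0, 1] -> T2 x v <= T1 x v.
Proof.
have I1 : (1 : R) \in `[0, 1] by rewrite in_itv /= ler01 lexx.
move=> D x01 v01; have := D x 1 1 v x01 I1 I1 v01.
by rewrite !tnormx1 // !tnorm1x.
Qed.

Lemma tnorm_eq1 T x y : x \in `[0, 1] -> y \in `[0, 1] ->
  T x y = 1 -> x = 1 /\ y = 1.
Proof.
move=> x01 y01 Txy; have := tnorm_le T x y x01 y01; rewrite Txy.
by move: x01 y01; rewrite !in_itv /= => ? ? ?; split; lra.
Qed.

(** The smaller side vanishes unless [T x u] or [T y v] is 1, which forces both arguments of that
    term to be 1; then the two sides coincide. *)
Lemma dominates_drastic T (h : (0 <= +oo :> \bar R)%E) : dominates T (SW h).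
Proof.
move=> x y u v x01 y01 u01 v01.
have I01 T' a b : a \in `[0, 1] -> b \in `[0, 1] -> T' a b \in `[0, 1].
  by move=> a01 b01; apply: (tnorm_itv T').
have I1 : (1 : R) \in `[0, 1] by rewrite in_itv /= ler01 lexx.
have [E|nxu] := eqVneq (T x u) 1.
  case: (tnorm_eq1 T x u x01 u01 E) => -> ->.
  by rewrite (tnorm1x T I1) !(tnorm1x (SW h)) ?I01.
have [E|nyv] := eqVneq (T y v) 1.
  case: (tnorm_eq1 T y v y01 v01 E) => -> ->.
  by rewrite (tnorm1x T I1) !(tnormx1 (SW h)) ?I01.
have -> : SW h (T x u) (T y v) = 0.
  by rewrite /= /SW_fun; case: leP; rewrite ?(negPf nxu) ?(negPf nyv).
by have := I01 T _ _ (I01 (SW h) _ _ x01 y01) (I01 (SW h) _ _ u01 v01);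
  rewrite in_itv => /andP[].
Qed.

(** * Passage to complements for finite parameters *)

Lemma in01_compl a : (1 - a \in `[0, 1]) = (0 <= a <= 1).
Proof. by rewrite in_itv /= subr_ge0 gerBl andbC. Qed.

Lemma SW_compl l (h : (0 <= l%:E)%E) a b : 0 <= a <= 1 -> 0 <= b <= 1 ->
  SW h (1 - a) (1 - b) = Num.max 0 (1 - csum (l - 1) a b).
Proof.
move=> /andP[a0 a1] /andP[b0 b1]; rewrite /= /csum.
case: eqP => [->|_]; last by congr Num.max; ring.
rewrite max_r; first by ring.
have : 0 <= (1 - a) * (1 - b) by rewrite mulr_ge0 // subr_ge0.
by congr (_ <= _); ring.
Qed.

Lemma max0B1 (t : R) : Num.max 0 (1 - t) = 1 - Num.min 1 t.
Proof. by rewrite /Num.max /Num.min; case: ifP; case: ifP; lra. Qed.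

(** In complements each t-norm is [csum] clipped at 1. If the right-hand side reaches 1 the
    inequality is trivial; otherwise no clipping on either side matters and [csum_swap] computes the
    difference. *)
Lemma SW_dominates_csum l m (hl : (0 <= l%:E)%E) (hm : (0 <= m%:E)%E) :
  dominates (SW hl) (SW hm) <->
  forall x y u v, 0 <= x <= 1 -> 0 <= y <= 1 -> 0 <= u <= 1 -> 0 <= v <= 1 ->
    csum (l - 1) x u < 1 -> csum (l - 1) y v < 1 ->
    csum (m - 1) (csum (l - 1) x u) (csum (l - 1) y v) < 1 ->
    0 <= (m - l) * (x * v + u * y - (l - 1) * (m - 1) * (x * y * u * v)).
Proof.
have p1 : -1 <= l - 1 by move: hl; rewrite lee_fin; lra.
have q1 : -1 <= m - 1 by move: hm; rewrite lee_fin; lra.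
have csum_ge0 k a b : -1 <= k -> 0 <= a <= 1 -> 0 <= b <= 1 ->
    0 <= csum k a b.
  by move=> k1 /andP[a0 a1] b01; apply: le_trans (le_csum _ _ _ k1 a0 b01 a1).
pose S k a b := Num.min 1 (csum k a b).
have S01 k a b : -1 <= k -> 0 <= a <= 1 -> 0 <= b <= 1 -> 0 <= S k a b <= 1.
  by move=> k1 a01 b01; rewrite le_min ler01 csum_ge0 //= ge_min lexx.
have SWS j (hj : (0 <= j%:E)%E) a b : 0 <= a <= 1 -> 0 <= b <= 1 ->
    SW hj (1 - a) (1 - b) = 1 - S (j - 1) a b.
  by move=> a01 b01; rewrite SW_compl // max0B1.
have S_lt1 k a b : S k a b < 1 -> S k a b = csum k a b.
  by rewrite /S gt_min ltxx => /ltW/min_r.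
have S_csum k a b : csum k a b < 1 -> S k a b = csum k a b.
  by move=> lt1; rewrite /S min_r // ltW.
have le_S k a b : -1 <= k -> 0 <= a <= 1 -> 0 <= b <= 1 ->
    a <= S k a b /\ b <= S k a b.
  move=> k1 a01 b01; case/andP: (a01) => a0 a1; case/andP: (b01) => b0 b1.
  by rewrite !le_min a1 b1 le_csum // csumC le_csum.
have SD : dominates (SW hl) (SW hm) <->
    forall x y u v, 0 <= x <= 1 -> 0 <= y <= 1 -> 0 <= u <= 1 -> 0 <= v <= 1 ->
      S (l - 1) (S (m - 1) x y) (S (m - 1) u v) <=
      S (m - 1) (S (l - 1) x u) (S (l - 1) y v).
  split=> [D x y u v x01 y01 u01 v01|D x y u v].
    have := D (1 - x) (1 - y) (1 - u) (1 - v).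
    rewrite !in01_compl => /(_ x01 y01 u01 v01).
    by rewrite !SWS ?S01 // lerD2l lerN2.
  rewrite -[x](subKr 1) -[y](subKr 1) -[u](subKr 1) -[v](subKr 1) !in01_compl.
  by move=> x01 y01 u01 v01; rewrite !SWS ?S01 // lerD2l lerN2; apply: D.
apply: (iff_trans SD); split=> H x y u v x01 y01 u01 v01.
  move=> xu1 yv1 Rlt1.
  have := H x y u v x01 y01 u01 v01.
  rewrite (S_csum _ _ _ xu1) (S_csum _ _ _ yv1) (S_csum _ _ _ Rlt1) => le1.
  (* A clipped sum is at least each of its arguments, so the strict bound by 1 passes from the outer
     left-hand sum to the inner ones. *)
  have lt1 := le_lt_trans le1 Rlt1.
  have [Sxy Suv] := le_S (l - 1) (S (m - 1) x y) (S (m - 1) u v) p1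
    (S01 _ _ _ q1 x01 y01) (S01 _ _ _ q1 u01 v01).
  move: le1; rewrite S_lt1 // S_lt1 ?(le_lt_trans Sxy) //.
  rewrite S_lt1 ?(le_lt_trans Suv) // -subr_ge0 csum_swap.
  by congr (0 <= _); ring.
have [|Rlt1] := leP 1 (csum (m - 1) (S (l - 1) x u) (S (l - 1) y v)).
  by move=> R1; rewrite [leRHS]min_l // ge_min lexx.
have := le_S (m - 1) (S (l - 1) x u) (S (l - 1) y v) q1
  (S01 _ _ _ p1 x01 u01) (S01 _ _ _ p1 y01 v01).
rewrite (S_csum _ _ _ Rlt1) => -[/le_lt_trans/(_ Rlt1) xu1].
move=> /le_lt_trans/(_ Rlt1) yv1.
have Sxu := S_lt1 _ _ _ xu1; have Syv := S_lt1 _ _ _ yv1.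
rewrite Sxu Syv in xu1 yv1 Rlt1 *.
have [[xxu uxu] [yyv vyv]] : (x <= csum (l - 1) x u /\ u <= csum (l - 1) x u) /\
    (y <= csum (l - 1) y v /\ v <= csum (l - 1) y v).
  by rewrite -Sxu -Syv; split; apply: le_S.
have mono a b c d : 0 <= a -> a <= c -> c < 1 -> 0 <= b -> b <= d -> d < 1 ->
    csum (m - 1) a b <= csum (m - 1) c d.
  move=> a0 ac c1 b0 bd d1.
  apply: (@le_trans _ _ (csum (m - 1) c b)).
    by apply: csum_le; rewrite // b0 ltW // (le_lt_trans bd).
  rewrite csumC [leRHS]csumC; apply: csum_le => //.
  by rewrite (le_trans a0 ac) ltW.
case/andP: x01 (x01) => x0 _ x01; case/andP: y01 (y01) => y0 _ y01.
case/andP: u01 (u01) => u0 _ u01; case/andP: v01 (v01) => v0 _ v01.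
(* By monotonicity the sums of [x, y] and of [u, v] are at most the right-hand value, hence below 1;
   the outer left-hand clip only decreases its sum. *)
rewrite (S_csum _ x y) ?(le_lt_trans _ Rlt1) ?mono //.
rewrite (S_csum _ u v) ?(le_lt_trans _ Rlt1) ?mono //.
apply: (@le_trans _ _ (csum (l - 1) (csum (m - 1) x y) (csum (m - 1) u v))).
  by rewrite ge_min lexx orbT.
rewrite -subr_ge0 csum_swap.
have := H x y u v x01 y01 u01 v01 xu1 yv1 Rlt1.
by congr (0 <= _); ring.
Qed.

(** * Comparison of parameters and the criterion for [l < m] *)

Lemma SW_dominates_le l m (hl : (0 <= l%:E)%E) (hm : (0 <= m%:E)%E) :
  dominates (SW hl) (SW hm) -> l <= m.
Proof.
move=> D; rewrite leNgt; apply/negP => ml.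
have m0 : 0 <= m by rewrite -lee_fin.
(* This [e] is small enough for [SW hm] to be positive at [(1 - e, 1 - e)], where [m < l] makes
   [SW hl] strictly smaller and contradicts [dominates_le]. *)
pose e := (4 + m)^-1.
have e0 : 0 < e by rewrite invr_gt0; lra.
have e1 : e * (4 + m) = 1 by rewrite mulVf // gt_eqF //; lra.
have em : 0 <= e * m by rewrite mulr_ge0 // ltW.
have e01 : 0 <= e <= 1 by rewrite ltW //=; lra.
have := dominates_le (SW hl) (SW hm) (1 - e) (1 - e) D.
rewrite !in01_compl !SW_compl // => /(_ e01 e01).
have emm : e * (e * m) <= 1 * (e * m) by rewrite ler_wpM2r //; lra.
have ee : 0 < (l - m) * (e * e) by rewrite mulr_gt0 ?subr_gt0 // mulr_gt0.
have : csum (m - 1) e e < csum (l - 1) e e by rewrite /csum; lra.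
have : csum (m - 1) e e < 1.
  have ee0 : 0 < e * e by rewrite mulr_gt0.
  by rewrite /csum; lra.
by rewrite !max0B1; move=> h1 h2; rewrite lerD2l lerN2 (min_r (ltW h1));
  rewrite ge_min !leNgt h1 h2.
Qed.

Lemma SW_drastic_not_dominates m (h : (0 <= +oo :> \bar R)%E)
  (hm : (0 <= m%:E)%E) : ~ dominates (SW h) (SW hm).
Proof.
move=> D.
have m0 : 0 <= m by rewrite -lee_fin.
(* At [(1 - e, 1 - e)] the drastic product is 0, whereas [SW hm] is still positive. *)
pose e := (4 + m)^-1.
have e0 : 0 < e by rewrite invr_gt0; lra.
have e1 : e * (4 + m) = 1 by rewrite mulVf // gt_eqF //; lra.
have em : 0 <= e * m by rewrite mulr_ge0 // ltW.
have e01 : 0 <= e <= 1 by rewrite ltW //=; lra.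
have := dominates_le (SW h) (SW hm) (1 - e) (1 - e) D.
rewrite !in01_compl SW_compl // => /(_ e01 e01).
have emm : e * (e * m) <= 1 * (e * m) by rewrite ler_wpM2r //; lra.
rewrite /= /SW_fun maxxx ifF; last by apply/eqP; lra.
have ee0 : 0 < e * e by rewrite mulr_gt0.
by rewrite ge_max /csum => /andP[_]; lra.
Qed.

Lemma SW_dominates_lt l m (hl : (0 <= l%:E)%E) (hm : (0 <= m%:E)%E) :
  l < m -> dominates (SW hl) (SW hm) <->
  (3 < Num.sqrt m -> (l - 1) * (Num.sqrt m - 3) ^+ 2 <= 8 * (m - 1)).
Proof.
move=> lm; set s := Num.sqrt m.
have l0 : 0 <= l by rewrite -lee_fin.
have m0 : 0 <= m by rewrite -lee_fin.
have s0 : 0 <= s by rewrite sqrtr_ge0.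
have qs : m - 1 = s ^+ 2 - 1 by rewrite sqr_sqrtr.
apply: (iff_trans (SW_dominates_csum _ _ _ _)); split.
  move=> H s3; rewrite leNgt; apply/negP => psq.
  have q0 : 0 < m - 1 by rewrite qs; nra.
  have [a /andP[a0 a1] [Rlt1 a2]] := csum_diag_violation _ _ _ q0 qs s3 psq.
  have a01 : 0 <= a <= 1 by rewrite !ltW.
  have p0 : 0 <= l - 1.
    by rewrite leNgt; apply/negP => p0; have := sqr_ge0 (s - 3); nra.
  (* The outer sum only adds nonnegative terms to [csum (l - 1) a a], so it inherits the bound
     [Rlt1]. *)
  have m1 : csum (l - 1) a a < 1.
    have A0 : 0 <= csum (l - 1) a a.
      by rewrite /csum !addr_ge0 // ?mulr_ge0 // ltW.
    apply: le_lt_trans Rlt1; rewrite {2}/csum -mulrA -addrA lerDl.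
    by rewrite addr_ge0 // !mulr_ge0 // ltW.
  have := H a a a a a01 a01 a01 a01 m1 m1 Rlt1.
  rewrite pmulr_rge0 ?subr_gt0 //.
  have -> : a * a + a * a - (l - 1) * (m - 1) * (a * a * a * a) =
    a ^+ 2 * (2 - (l - 1) * (m - 1) * a ^+ 2) by ring.
  by rewrite pmulr_rge0 ?exprn_gt0 //; lra.
move=> H x y u v x01 y01 u01 v01 _ _ Rlt1.
rewrite pmulr_rge0 ?subr_gt0 // subr_ge0.
by apply: (csum_dominance _ _ s); rewrite // ?ltrD2r; lra.
Qed.

(** Clearing the denominator, this is the identity [(1 - 3 s) ^ 2 - (s - 3) ^ 2 = 8 (s ^ 2 - 1)]. *)
Lemma SW_bound l s : 3 < s ->
  (l <= ((1 - 3 * s) / (3 - s)) ^+ 2) =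
  ((l - 1) * (s - 3) ^+ 2 <= 8 * (s ^+ 2 - 1)).
Proof.
move=> s3; rewrite expr_div_n ler_pdivlMr; last by rewrite exprn_even_gt0 //=; lra.
by rewrite -subr_ge0 -[RHS]subr_ge0; congr (0 <= _); ring.
Qed.

End Dominance.

(** * Classification of dominance by the two parameters *)

Theorem theorem2 (R : realType) (lambda mu : \bar R)
    (lambda_ge0 : (0 <= lambda)%E) (mu_ge0 : (0 <= mu)%E) :
  dominates (SW lambda_ge0) (SW mu_ge0) <->
  (lambda = 0%E
   \/ mu = +oo%E
   \/ lambda = mu
   \/ ((0 < lambda)%E /\ (lambda < mu)%E
       /\ (mu <= (17 + 12 * Num.sqrt 2)%:E)%E)
   \/ (((17 + 12 * Num.sqrt 2)%:E < mu)%E /\ (mu < +oo)%E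
       /\ (0 < lambda)%E
       /\ (lambda <= (((1 - 3 * Num.sqrt (fine mu))
                        / (3 - Num.sqrt (fine mu))) ^+ 2)%:E)%E)).
Proof.
case: mu mu_ge0 => [m| |] // hm; last first.
  by split=> [_|_]; [right; left | exact: dominates_drastic].
case: lambda lambda_ge0 => [l| |] // hl; last first.
  split=> [/SW_drastic_not_dominates //|].
  by case=> [|[|[|[[_ []]|[_ [_ [_]]]]]]].
rewrite !lee_fin !lte_fin /= ltry.
set s := Num.sqrt m.
have m0 : 0 <= m by rewrite -lee_fin.
have l0 : 0 <= l by rewrite -lee_fin.
have s0 : 0 <= s by rewrite sqrtr_ge0.
have ms : m = s ^+ 2 by rewrite sqr_sqrtr.
pose r : R := Num.sqrt 2.
have r0 : 0 <= r by rewrite sqrtr_ge0.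
have r2 : r ^+ 2 = 2 by rewrite sqr_sqrtr.
(* The threshold is the value of [m] at which [s > 3] satisfies [(s - 3) ^ 2 = 8], where the
   criterion's bound on [l] is exactly [m]. *)
have K2 : 17 + 12 * r = (3 + 2 * r) ^+ 2.
  by rewrite sqrrD exprMn r2; ring.
rewrite -/r.
have leK : (m <= 17 + 12 * r) = (s <= 3 + 2 * r).
  by rewrite K2 ms ler_pXn2r ?nnegrE //; lra.
have ltK : (17 + 12 * r < m) = (3 + 2 * r < s) by rewrite !ltNge leK.
rewrite leK ltK.
split.
  move=> D; have lm := SW_dominates_le _ _ _ _ D.
  have [->|l0'] := eqVneq l 0; first by left.
  have lpos : 0 < l by rewrite lt_def l0' l0.
  have [->|lm'] := eqVneq l m; first by right; right; left.
  have ltlm : l < m by rewrite lt_def eq_sym lm' lm.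
  right; right; right.
  have [sK|Ks] := leP s (3 + 2 * r); first by left.
  right; do 3!split=> //.
  have s3 : 3 < s by lra.
  have := (SW_dominates_lt _ _ hl hm ltlm).1 D s3.
  by rewrite -/s SW_bound // ms.
have refl : l = m -> dominates (SW hl) (SW hm).
  move=> lm; apply/SW_dominates_csum => *.
  by rewrite lm subrr mul0r.
have suff_lt (lm : l < m) := (SW_dominates_lt _ _ hl hm lm).2.
case=> [[lE]|[//|[[/refl//]|[[lpos [lm sK]]|[Ks [_ [lpos lle]]]]]]].
- have [m0E|mn0] := eqVneq m 0; first by apply: refl; rewrite lE m0E.
  apply: suff_lt; first by rewrite lE lt_def mn0 m0.
  (* With [l = 0] the left side of the criterion is [- (s - 3) ^ 2], while the right side is
     positive. *)
  by rewrite -/s lE ms => s3; have := sqr_ge0 (s - 3); nra.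
- apply: suff_lt => //; rewrite -/s ms => s3.
  have s38 : (s - 3) ^+ 2 <= 8.
    have -> : 8 = (2 * r) ^+ 2 by rewrite exprMn r2; ring.
    by rewrite ler_pXn2r ?nnegrE //; lra.
  apply: (@le_trans _ _ ((s ^+ 2 - 1) * (s - 3) ^+ 2)).
    by rewrite ler_wpM2r ?sqr_ge0 // -ms; lra.
  by rewrite mulrC ler_wpM2r //; nra.
- have s3 : 3 < s by lra.
  move: lle; rewrite SW_bound // => lle.
  apply: suff_lt; last by rewrite -/s {1}ms.
  (* The criterion needs [l < m], which follows here from [(l - 1) (s - 3) ^ 2 <= 8 (m - 1) < (m -
     1) (s - 3) ^ 2]. *)
  have s38 : 8 < (s - 3) ^+ 2.
    have -> : 8 = (2 * r) ^+ 2 by rewrite exprMn r2; ring.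
    by rewrite ltr_pXn2r ?nnegrE //; lra.
  have q0 : 0 < s ^+ 2 - 1 by nra.
  have : (l - 1) * (s - 3) ^+ 2 < (s ^+ 2 - 1) * (s - 3) ^+ 2.
    by apply: le_lt_trans lle _; rewrite mulrC ltr_pM2l.
  by rewrite ltr_pM2r; lra.
Qed.
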